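(* Let $Q$ and $A$ be quandles. If $A$ is abelian, then the set $\mathrm{Hom}(Q,A)$ of quandle homomorphisms from $Q$ to $A$ is a quandle under the pointwise operation $(f\triangleright g)(q)=f(q)\triangleright g(q)$ for $q\in Q$. Moreover, this quandle $\mathrm{Hom}(Q,A)$ is abelian.
   Context: A quandle is a set $X$ with a binary operation $\triangleright:X\times X\to X$ such that (i) $x\triangleright x=x$ for all $x\in X$; (ii) for all $x,y\in X$ there is a unique $z\in X$ with $x=z\triangleright y$; (iii) $(x\triangleright y)\triangleright z=(x\triangleright z)\triangleright(y\triangleright z)$ for all $x,y,z\in X$. A quandle homomorphism $f:X\to Y$ is a map with $f(x\triangleright y)=f(x)\triangleright f(y)$ for all $x,y\in X$. A quandle $X$ is abelian (also called medial) if $(x\triangleright y)\triangleright(z\triangleright w)=(x\triangleright z)\triangleright(y\triangleright w)$ for all $x,y,z,w\in X$. *)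

(* Defs.v *)
Set Implicit Arguments.
Unset Strict Implicit.

Definition is_quandle (X : Type) (op : X -> X -> X) : Prop :=
  (forall x : X, op x x = x) /\
  (forall x y : X, exists! z : X, x = op z y) /\
  (forall x y z : X, op (op x y) z = op (op x z) (op y z)).

Definition is_abelian (X : Type) (op : X -> X -> X) : Prop :=
  forall x y z w : X, op (op x y) (op z w) = op (op x z) (op y w).

Record quandle : Type := Quandle {
  quandle_carrier :> Type;
  quandle_op : quandle_carrier -> quandle_carrier -> quandle_carrier;
  quandle_axioms : is_quandle quandle_op
}.

Declare Scope quandle_scope.
Delimit Scope quandle_scope with quandle.
Notation "x ▷ y" := (quandle_op x y)
  (at level 40, left associativity) : quandle_scope.
Open Scope quandle_scope.

(* Equality of homomorphisms is Leibniz equality of these records; it coincides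
   with pointwise equality of the underlying maps only under functional
   extensionality and proof irrelevance. *)
Record quandle_hom (X Y : quandle) : Type := QuandleHom {
  hom_fun :> X -> Y;
  hom_morph : forall x y : X, hom_fun (x ▷ y) = hom_fun x ▷ hom_fun y
}.

(* Main.v *)
Require Import Defs.
From Stdlib Require Import FunctionalExtensionality ProofIrrelevance
  IndefiniteDescription.

(** Homomorphisms are determined by their values, so idempotence,
    self-distributivity and mediality of the pointwise operation follow value by
    value from the same laws in [A].

    Mediality of [A] says that its operation [A × A -> A] is itself a quandle
    homomorphism; this is what makes the pointwise product of two homomorphisms
    a homomorphism ([hom_op]).  The remaining axiom asks to solve [f = h ▷ g] for
    a homomorphism [h].  At each point the equation has exactly one solution in
    [A], hence there is exactly one candidate map [h], and it has to be shown
    that [h] preserves the operation.  It does because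
    [f (x ▷ y) = (h x ▷ g x) ▷ (h y ▷ g y) = (h x ▷ h y) ▷ g (x ▷ y)], again by
    mediality, so that [h x ▷ h y] and [h (x ▷ y)] divide the same element by
    [g (x ▷ y)] ([hom_div]). *)

Lemma quandle_op_cancel_r (X : quandle) (a b c : X) :
  a ▷ c = b ▷ c -> a = b.
Proof.
  intros E. destruct (quandle_axioms X) as (_ & Hdiv & _).
  destruct (Hdiv (a ▷ c) c) as (d & _ & Hd).
  rewrite <- (Hd a eq_refl). exact (Hd b E).
Qed.

Lemma quandle_hom_ext (X Y : quandle) (f g : quandle_hom X Y) :
  (forall x, f x = g x) -> f = g.
Proof.
  destruct f as [f Hf], g as [g Hg]; simpl; intros E.
  apply functional_extensionality in E. subst g.
  f_equal. apply proof_irrelevance.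
Qed.

Definition hom_op (Q A : quandle) (hA : is_abelian (@quandle_op A))
  (f g : quandle_hom Q A) : quandle_hom Q A.
Proof.
  refine (@QuandleHom Q A (fun q => f q ▷ g q) _).
  abstract (intros x y; rewrite !hom_morph; apply hA).
Defined.

(** The pointwise quotients are chosen by description; by uniqueness of the
    quotient the choice is forced, which is what makes the resulting map a
    homomorphism. *)
Lemma hom_div (Q A : quandle) (hA : is_abelian (@quandle_op A))
  (f g : quandle_hom Q A) :
  exists h : quandle_hom Q A, forall q, f q = h q ▷ g q.
Proof.
  destruct (quandle_axioms A) as (_ & Hdiv & _).
  destruct (functional_choice (fun q z => f q = z ▷ g q)) as [h Hh].
  { intros q. destruct (Hdiv (f q) (g q)) as (z & Hz & _). now exists z. }
  assert (Hmorph : forall x y, h (x ▷ y) = h x ▷ h y).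
  { intros x y. apply (quandle_op_cancel_r A _ _ (g (x ▷ y))).
    rewrite <- Hh, !hom_morph, (Hh x), (Hh y). apply hA. }
  now exists (QuandleHom Hmorph).
Qed.

Theorem theorem3 (Q A : quandle) (hA : is_abelian (@quandle_op A)) :
  exists op : quandle_hom Q A -> quandle_hom Q A -> quandle_hom Q A,
    (forall (f g : quandle_hom Q A) (q : Q), op f g q = f q ▷ g q) /\
    is_quandle op /\
    is_abelian op.
Proof.
  destruct (quandle_axioms A) as (Hidem & _ & Hdist).
  exists (hom_op Q A hA). repeat split.
  - intros f. apply quandle_hom_ext; intros q. apply Hidem.
  - intros f g. destruct (hom_div Q A hA f g) as [h Hh]. exists h. split.
    + apply quandle_hom_ext; intros q. apply Hh.
    + intros h' E. apply quandle_hom_ext; intros q.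
      apply (quandle_op_cancel_r A _ _ (g q)).
      rewrite <- Hh, E. reflexivity.
  - intros f g h. apply quandle_hom_ext; intros q. apply Hdist.
  - intros f g h k. apply quandle_hom_ext; intros q. apply hA.
Qed.
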